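(* Let $\mu\in\mathcal M^+(\mathbb R)\setminus\{0\}$ satisfy $\|\mu\|_1\le 1$, and let $c\in I$ be a solution of $$c_t(x,t)=H(c,x,t)^2\int_{z\ne x}K'''(c(x,t)-c(z,t))\,d\mu(z),\qquad c(x,0)=x,\qquad (x,t)\in\mathbb R\times(0,\infty).$$ Let $h(t)=c(\cdot,t)_*\mu$ (push-forward measure) and $\bar h(t)=K*h(t)$, $t\in\mathbb R^+$. Then $\bar h(t)\in H^3(\mathbb R)$ for all $t\in\mathbb R^+$. Moreover $\bar h\in C_b^{0,\frac12}(\mathbb R^+;H^3(\mathbb R))$.
   Context: $\mathbb R^+=[0,\infty)$. $\alpha>0$ is a fixed constant and $K(x)=\frac1{4\alpha^2}(\alpha+|x|)e^{-|x|/\alpha}$; $K'''$ is its classical third derivative, defined on $\mathbb R\setminus\{0\}$. $\mathcal M^+(\mathbb R)$ is the set of finite positive Borel measures on $\mathbb R$ and $\|\cdot\|_1$ is the total variation norm. $I=I_{\mathbb R}$ is the set of locally bounded functions $c:\mathbb R\times\mathbb R^+\to\mathbb R$ such that $c(\cdot,t)$ is Borel measurable for all $t\in\mathbb R^+$, $c(x,\cdot)$ is $C^1$ for all $x\in\mathbb R$, and $c(x,t)<c(y,t)$ for all $t\in\mathbb R^+$ and all $x<y$. $H(c,x,t)=\int_{-\infty}^\infty K(c(x,t)-c(z,t))\,d\mu(z)$. $H^3(\mathbb R)$ is the usual $L^2$-based Sobolev space. $C_b^{0,\frac12}(\mathbb R^+;H^3(\mathbb R))$ is the space of $\frac12$-H\''older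 continuous functions $u:\mathbb R^+\to H^3(\mathbb R)$ that are bounded in the sense that $\sup_{t\in\mathbb R^+}\|u(t)\|_{H^3(\mathbb R)}<\infty$. *)

(* Defs.v *)
From HB Require Import structures.
From mathcomp Require Import all_boot all_order all_algebra.
From mathcomp Require Import all_classical all_reals all_analysis.

Set Implicit Arguments.
Unset Strict Implicit.
Unset Printing Implicit Defensive.

Import Order.TTheory GRing.Theory Num.Theory.
Import numFieldNormedType.Exports.

Local Open Scope classical_set_scope.
Local Open Scope ring_scope.

Definition Rnneg {R : realType} : set R := [set t | 0 <= t].

Definition tv_norm {R : realType} (nu : set R -> \bar R) : \bar R :=
  ereal_sup [set s | exists (n : nat) (A : (set R)^nat),
    [/\ forall i, measurable (A i), trivIset setT A &
        s = (\sum_(i < n) `|nu (A i)|)%E]].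

Definition deriv_on {R : realType} (A : set R) (f : R -> R) (t d : R) : Prop :=
  (f s - f t) / (s - t) @[s --> within A t^'] --> d.

Definition C1_on {R : realType} (A : set R) (f : R -> R) : Prop :=
  exists d : R -> R,
    (forall t, A t -> deriv_on A f t (d t)) /\ {within A, continuous d}.

(* A map on R x [0, +oo[ is represented by a total function; only its values
   at times t >= 0 are constrained. *)
Definition class_I {R : realType} (c : R -> R -> R) : Prop :=
  [/\ [locally [bounded c p.1 p.2 | p in [set p : R * R | Rnneg p.2]]],
      forall t, Rnneg t -> measurable_fun setT (c^~ t),
      forall x, C1_on Rnneg (c x) &
      forall t x y, Rnneg t -> x < y -> c x t < c y t].

Definition kernelK {R : realType} (alpha x : R) : R :=
  (4 * alpha ^+ 2)^-1 * (alpha + `|x|) * expR (- `|x| / alpha).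

Definition Hfun {R : realType} (alpha : R)
    (mu : {finite_measure set R -> \bar R}) (c : R -> R -> R) (x t : R) : R :=
  \int[mu]_z kernelK alpha (c x t - c z t).

(* derive1n 3 (kernelK alpha) is meaningful only away from 0; the integrand below is
   evaluated away from 0 because c(., t) is strictly increasing. *)
Definition is_solution {R : realType} (alpha : R)
    (mu : {finite_measure set R -> \bar R}) (c : R -> R -> R) : Prop :=
  (forall x, c x 0 = x) /\
  (forall x t : R, 0 < t ->
     is_derive t (1 : R) (c x)
       (Hfun alpha mu c x t ^+ 2 *
        \int[mu]_(z in [set z | z != x])
           derive1n 3 (kernelK alpha) (c x t - c z t))).

Definition convolution {R : realType} (f : R -> R) (nu : set R -> \bar R)
    (x : R) : R :=
  fine (\int[nu]_y (f (x - y))%:E)%E.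

Definition hmeas {R : realType} (mu : {finite_measure set R -> \bar R})
    (c : R -> R -> R) (t : R) : set R -> \bar R :=
  pushforward mu (c^~ t).

Definition hbar {R : realType} (alpha : R)
    (mu : {finite_measure set R -> \bar R}) (c : R -> R -> R) (t : R) :
    R -> R :=
  convolution (kernelK alpha) (hmeas mu c t).

Definition test_function {R : realType} (phi : R -> R) : Prop :=
  (forall n x, derivable (derive1n n phi) x 1) /\
  compact (closure [set x | phi x != 0]).

Definition is_weak_deriv {R : realType} (k : nat) (u g : R -> R) : Prop :=
  [/\ locally_integrable setT u, locally_integrable setT g &
      forall phi : R -> R, test_function phi ->
        \int[lebesgue_measure]_x (u x * derive1n k phi x) =
        (-1) ^+ k * \int[lebesgue_measure]_x (g x * phi x)].

Definition sobolev_derivs {R : realType} (m : nat) (u : R -> R)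
    (g : nat -> R -> R) : Prop :=
  g 0%N = u /\
  forall k, (k <= m)%N ->
    g k \in Lfun (@lebesgue_measure R) 2%:E /\ is_weak_deriv k u (g k).

Definition sobolev {R : realType} (m : nat) : set (R -> R) :=
  [set u | exists g, sobolev_derivs m u g].

(* Weak derivatives are unique almost everywhere, so the infimum is over a
   single value when u is in H^m; it is +oo when u is not in H^m. *)
Definition sobolev_norm {R : realType} (m : nat) (u : R -> R) : \bar R :=
  ereal_inf [set (Num.sqrt (\sum_(k < m.+1)
      fine ('N[@lebesgue_measure R]_2%:E[EFin \o g k])%E ^+ 2))%:E
    | g in sobolev_derivs m u].

(* The space C_b^{0,gamma}([0, +oo[; H^m(R)). *)
Definition Cb_hoelder_sobolev {R : realType} (gamma : R) (m : nat)
    (u : R -> R -> R) : Prop :=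
  [/\ forall t, Rnneg t -> sobolev m (u t),
      exists C : R, forall s t : R, Rnneg s -> Rnneg t ->
        (sobolev_norm m (fun x => u t x - u s x)%R <= (C * `|t - s| `^ gamma)%:E)%E &
      (ereal_sup [set sobolev_norm m (u t) | t in Rnneg] < +oo)%E].

(* Main.v *)
Require Import Defs.
From mathcomp Require Import all_boot all_order all_algebra.
From mathcomp Require Import all_classical all_reals all_analysis.
From mathcomp Require Import measurable_realfun ring lra.

(* The derivatives K', K'' and K''' (the last one off 0) are bounded by an
   exponential and are Lipschitz on each side of 0, with at most a jump at 0.
   Splitting according to whether 0 lies between x - a and x - b gives
     |K^(k)(x - a) - K^(k)(x - b)|^2
       <= C (|a - b| (E(x - a) + E(x - b)) + 1_[a,b](x))
   with E integrable, hence |K^(k)(. - a) - K^(k)(. - b)|_2 <= C' |a - b|^(1/2).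
   Integration by parts on both sides of a shows that these functions are the
   weak derivatives of K(. - a).  As hbar(t) is the superposition of the
   K(. - c(z,t)) against mu, its weak derivatives are the superpositions of the
   K^(k)(. - c(z,t)) (Fubini), and L^2 bounds that are uniform in z pass to the
   superposition (Jensen and Tonelli).  The equation makes c(z, .) Lipschitz
   uniformly in z, because the right-hand side is bounded. *)

Set Implicit Arguments.
Unset Strict Implicit.
Unset Printing Implicit Defensive.

Import Order.TTheory GRing.Theory Num.Theory.
Import numFieldNormedType.Exports.

Local Open Scope classical_set_scope.
Local Open Scope ring_scope.

Lemma eq_derive1n (R : realType) (U : set R) (f g : R -> R) k : open U ->
  (forall x, U x -> f x = g x) ->
  forall x, U x -> derive1n k f x = derive1n k g x.
Proof.
move=> oU fg; elim: k => [//|k IH] x Ux; rewrite !derive1nS !derive1E.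
apply: near_eq_derive; near=> y; apply: IH.
by near: y; exact: open_nbhs_nbhs.
Unshelve. all: by end_near. Qed.

(** * The kernel, its one-sided derivatives and their pointwise bounds *)

Section kernel.
Context {R : realType} (alpha : R) (alpha_gt0 : 0 < alpha).
Implicit Types (s x y : R) (p : R * R) (k : nat).

(* The signs s = 1 and s = -1 give the branches of K^(k) on x >= 0 and on x < 0,
   where s * x = |x|. *)
Definition expoly s p x : R :=
  (p.1 + p.2 * (s * x)) * expR (- (s * x) / alpha).

(** Differentiation preserves the family [expoly s], so it reduces to a linear map on coefficient
    pairs, and higher derivatives are its iterates. *)
Definition expoly_deriv s p : R * R :=
  (s * (p.2 - p.1 / alpha), - (s * p.2 / alpha)).

Definition expoly_coef s k : R * R :=
  iter k (expoly_deriv s) ((4 * alpha)^-1, (4 * alpha ^+ 2)^-1).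

(* K^(k); for k = 3 the value at 0 is that of the right branch. *)
Definition kernel_deriv k x : R :=
  if 0 <= x then expoly 1 (expoly_coef 1 k) x
  else expoly (-1) (expoly_coef (-1) k) x.

(* Half the decay rate of K, which leaves room for the polynomial factors. *)
Definition envelope x : R := expR (- (`|x| / (2 * alpha))).

Let alpha_neq0 : alpha != 0. Proof. exact: lt0r_neq0. Qed.

Lemma is_derive_expoly s p x :
  is_derive x (1 : R) (expoly s p) (expoly s (expoly_deriv s p) x).
Proof.
have h0 : is_derive x (1 : R) (fun y => - (s * y) / alpha) (- (s / alpha)).
  have -> : (fun y => - (s * y) / alpha) = ((- (s / alpha)) *: (id : R -> R)).
    by apply/funext => y; rewrite fctE /GRing.scale /=; ring.
  by apply: is_derive_eq; rewrite /GRing.scale/= mulr1.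
have h1 : is_derive x (1 : R) (fun y => expR (- (s * y) / alpha))
    (- (s / alpha) * expR (- (s * x) / alpha)).
  rewrite mulrC; exact: (@is_derive1_comp _ expR _ _ _ _ (is_derive_expR _) h0).
have h2 : is_derive x (1 : R) (fun y => p.1 + p.2 * (s * y)) (p.2 * s).
  have -> : (fun y => p.1 + p.2 * (s * y)) =
      (cst p.1 + (p.2 * s) *: (id : R -> R)).
    by apply/funext => y /=; rewrite /GRing.scale fctE/= mulrA.
  by apply: is_derive_eq; rewrite /GRing.scale/= mulr1 add0r.
have -> : expoly s p = ((fun y => p.1 + p.2 * (s * y)) *
   (fun y => expR (- (s * y) / alpha))) by [].
apply: is_derive_eq; rewrite /GRing.scale/= /expoly /expoly_deriv /=; field.
exact: alpha_neq0.
Qed.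

Lemma continuous_expoly s p : continuous (expoly s p).
Proof.
move=> x; apply/differentiable_continuous/derivable1_diffP.
by have [] := is_derive_expoly s p x.
Qed.

Lemma derive1n_expoly s k j :
  derive1n k (expoly s (expoly_coef s j)) = expoly s (expoly_coef s (k + j)).
Proof.
elim: k => [//|k IH]; rewrite derive1nS IH; apply/funext => x.
by rewrite derive1E; apply: derive_val; exact: is_derive_expoly.
Qed.

Lemma kernel_deriv0 : kernel_deriv 0 = kernelK alpha.
Proof.
apply/funext => x; rewrite /kernel_deriv /kernelK /expoly/=.
case: ifPn => [x0|]; first by rewrite ger0_norm// mul1r; field.
by rewrite -ltNge => x0; rewrite ltr0_norm// mulN1r; field.
Qed.

(** At 0 only the first coefficient survives. For k = 0, 1, 2 it is 1/(4 alpha), 0 and -1/(4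
    alpha^3) on both branches; for k = 3 it is s/(2 alpha^4), whence the jump of K'''. *)
Lemma kernel_deriv_cont0 k : (k < 3)%N ->
  expoly 1 (expoly_coef 1 k) 0 = expoly (-1) (expoly_coef (-1) k) 0.
Proof.
move=> k3; rewrite /expoly !mulr0; congr (_ * _).
by case: k k3 => [|[|[|]]]//= _; field.
Qed.

(** On each open half-line K coincides with a single smooth branch, and derivatives are local. This
    identifies the classical K''' of the equation with [kernel_deriv 3]. *)
Lemma derive1n_kernelK k x : x != 0 ->
  derive1n k (kernelK alpha) x = kernel_deriv k x.
Proof.
rewrite -kernel_deriv0 /kernel_deriv; case: (ltrgt0P x) => // x0 _.
- rewrite (@eq_derive1n _ [set y | 0 < y] _ (expoly 1 (expoly_coef 1 0)))//.
  + by rewrite derive1n_expoly addn0.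
  + by move=> y /= y0; rewrite ltW.
- rewrite (@eq_derive1n _ [set y | y < 0] _
    (expoly (-1) (expoly_coef (-1) 0)))//.
  + by rewrite derive1n_expoly addn0.
  + by move=> y /= y0; rewrite leNgt y0.
Qed.

Lemma envelope_gt0 x : 0 < envelope x. Proof. exact: expR_gt0. Qed.

Lemma envelope_le1 x : envelope x <= 1.
Proof.
rewrite -expR0 ler_expR oppr_le0 divr_ge0// mulr_ge0// ltW//.
Qed.

(** The exponential factors as e * e with e the envelope. One factor absorbs the linear term, as y *
    e <= 2 alpha follows from 1 + u <= exp u; the other one remains. *)
Lemma le_expoly s p x : s = 1 \/ s = -1 -> 0 <= s * x ->
  `|expoly s p x| <= (`|p.1| + 2 * alpha * `|p.2|) * envelope x.
Proof.
move=> s1 sx0.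
have xE : `|x| = s * x.
  case: s1 sx0 => ->; rewrite ?mul1r ?mulN1r; first exact: ger0_norm.
  by rewrite oppr_ge0; exact: ler0_norm.
rewrite /expoly /envelope xE normrM (ger0_norm (expR_ge0 _)).
set y := s * x in sx0 *; set e := expR (- (y / (2 * alpha))).
have -> : expR (- y / alpha) = e * e.
  by rewrite -expRD; congr expR; field.
have e0 : 0 < e by exact: expR_gt0.
have ye : y * e <= 2 * alpha.
  have : y / (2 * alpha) <= e^-1.
    rewrite /e -expRN opprK (le_trans _ (expR_ge1Dx _))//; lra.
  rewrite ler_pdivrMr ?mulr_gt0// => h.
  by rewrite -ler_pdivlMr// mulrC.
have e1 : e <= 1.
  by rewrite -expR0 ler_expR oppr_le0 divr_ge0// mulr_ge0// ltW.
rewrite mulrA ler_wpM2r ?(ltW e0)//.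
apply: (@le_trans _ _ ((`|p.1| + `|p.2| * y) * e)).
  rewrite ler_wpM2r ?(ltW e0)//.
  by rewrite (le_trans (ler_normD _ _))// normrM (ger0_norm sx0).
rewrite mulrDl lerD//; first by rewrite ler_piMr.
by rewrite -mulrA (mulrC _ `|p.2|) ler_wpM2l.
Qed.

Lemma kernel_deriv_env k : exists2 B, 0 <= B &
  forall x, `|kernel_deriv k x| <= B * envelope x.
Proof.
pose b s := `|(expoly_coef s k).1| + 2 * alpha * `|(expoly_coef s k).2|.
have b0 s : 0 <= b s by rewrite addr_ge0// !mulr_ge0// ltW.
(* The sum of the two branch constants stands in for their maximum. *)
exists (b 1 + b (-1)) => [|x]; first exact: addr_ge0.
have e0 := ltW (envelope_gt0 x).
rewrite /kernel_deriv; case: ifPn => [x0|]; last (rewrite -ltNge => x0).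
- apply: le_trans (le_expoly _ _ _) _; [by left|by rewrite mul1r|].
  by rewrite ler_wpM2r// lerDl.
- apply: le_trans (le_expoly _ _ _) _; [by right| |].
    by rewrite mulN1r oppr_ge0 ltW.
  by rewrite ler_wpM2r// lerDr.
Qed.

Lemma kernel_deriv_bounded k : exists B, forall x, `|kernel_deriv k x| <= B.
Proof.
have [B B0 BE] := kernel_deriv_env k.
exists B => x; rewrite (le_trans (BE x))// ler_piMr// envelope_le1//.
Qed.

(** Mean value theorem: the intermediate point lies on the same side of 0 as x and y, so [le_expoly]
    bounds the derivative there. *)
Lemma expoly_lipschitz s p x y : s = 1 \/ s = -1 -> 0 <= s * x -> 0 <= s * y ->
  `|expoly s p x - expoly s p y| <=
  (`|(expoly_deriv s p).1| + 2 * alpha * `|(expoly_deriv s p).2|) * `|x - y|.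
Proof.
move=> s1; wlog xy : x y / x <= y.
  move=> H sx sy; case: (leP x y) => [|/ltW] xy; first exact: H.
  by rewrite distrC (distrC x); apply: H.
move=> sx sy.
have [z zxy fE] : exists2 z, z \in `[x, y] &
    expoly s p y - expoly s p x = expoly s (expoly_deriv s p) z * (y - x).
  apply: MVT_segment => //; first by move=> z _; exact: is_derive_expoly.
  exact/continuous_subspaceT/continuous_expoly.
rewrite distrC fE normrM (distrC x) ler_wpM2r//.
have sz : 0 <= s * z.
  case: s1 sx sy => ->; rewrite ?mul1r ?mulN1r ?oppr_ge0 => x0 y0.
    by rewrite (le_trans x0)// (itvP zxy).
  by rewrite (le_trans _ y0)// (itvP zxy).
rewrite (le_trans (le_expoly _ s1 sz))// ler_piMr ?envelope_le1//.
by rewrite addr_ge0// !mulr_ge0// ltW.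
Qed.

(** The condition on signs keeps both points on one branch; across 0 the jump of K''' rules out such
    a bound for k = 3. *)
Lemma kernel_deriv_lipschitz k : exists2 B, 0 <= B &
  forall x y, (0 <= x) = (0 <= y) ->
    `|kernel_deriv k x - kernel_deriv k y| <= B * `|x - y|.
Proof.
pose q s := expoly_deriv s (expoly_coef s k).
pose b s := `|(q s).1| + 2 * alpha * `|(q s).2|.
have b0 s : 0 <= b s by rewrite addr_ge0// !mulr_ge0// ltW.
exists (b 1 + b (-1)) => [|x y xy]; first exact: addr_ge0.
rewrite /kernel_deriv -xy; case: ifPn => x0.
- apply: le_trans (expoly_lipschitz _ _ _ _) _; rewrite ?mul1r -?xy//.
    by left.
  by rewrite ler_wpM2r// lerDl.
- have y0 := x0; rewrite xy in y0.
  rewrite -ltNge in x0; rewrite -ltNge in y0.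
  apply: le_trans (expoly_lipschitz _ _ _ _) _.
  + by right.
  + by rewrite mulN1r oppr_ge0 ltW.
  + by rewrite mulN1r oppr_ge0 ltW.
  + by rewrite ler_wpM2r// lerDr.
Qed.

Lemma measurable_kernel_deriv k : measurable_fun [set: R] (kernel_deriv k).
Proof.
apply: measurable_fun_ifT.
- exact: measurable_fun_ler.
- by apply: continuous_measurable_fun; exact: continuous_expoly.
- by apply: continuous_measurable_fun; exact: continuous_expoly.
Qed.

Lemma continuous_envelope : continuous envelope.
Proof.
move=> x; apply: continuous_comp; last exact: continuous_expR.
apply: (@continuousN _ R); apply: (@continuousM _ R).
  exact: norm_continuous.
exact: cst_continuous.
Qed.

Lemma measurable_envelope : measurable_fun [set: R] envelope.
Proof. by apply: continuous_measurable_fun; exact: continuous_envelope. Qed.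

End kernel.

(** * Translation invariance of Lebesgue measure *)

Section translation.
Context {R : realType}.
Notation leb := (@lebesgue_measure R).
Local Open Scope ereal_scope.

Lemma measurable_translate (a : R) :
  measurable_fun [set: R] (fun x : R => (x - a)%R : measurableTypeR R).
Proof. exact: measurable_funB. Qed.

(** By uniqueness of Lebesgue measure it is enough to compare lengths of half-open intervals, whose
    preimages are translated intervals. *)
Lemma lebesgue_measure_translate (a : R) (A : set R) : measurable A ->
  pushforward leb (fun x : R => (x - a)%R : measurableTypeR R) A = leb A.
Proof.
move=> mA; apply/esym/lebesgue_measure_unique => //=.
  exact: measurable_translate.
move=> _ _ [[u v]] _ <-.
rewrite /pushforward /=.
have -> : (fun x : R => (x - a)%R) @^-1` `]u, v] =
    `](u + a)%R, (v + a)%R]%classic.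
  by apply/seteqP; split => x /=; rewrite !in_itv/= ltrBrDr lerBlDr.
rewrite !lebesgue_measure_itv/= !lte_fin ltrD2r; case: ifPn => // _.
by rewrite -EFinB -EFinB; congr EFin; ring.
Qed.

Lemma ge0_integral_translate (f : R -> \bar R) (a : R) :
  measurable_fun [set: R] f -> (forall x, 0 <= f x) ->
  \int[leb]_x f (x - a)%R = \int[leb]_x f x.
Proof.
move=> mf f0.
have := @ge0_integral_pushforward _ _ (measurableTypeR R) (measurableTypeR R) R
  _ (measurable_translate a) leb setT f measurableT mf (fun x _ => f0 x).
rewrite preimage_setT => <-.
apply: eq_measure_integral => /= [|mf' A mA _].
  exact: measurable_translate.
exact: lebesgue_measure_translate.
Qed.

End translation.

(** * The integral of the envelope *)

Section envelope.
Context {R : realType} (alpha : R) (alpha_gt0 : 0 < alpha).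
Notation leb := (@lebesgue_measure R).

(** By evenness this is twice the integral over the half-line, where -2 alpha exp(-x/(2 alpha)) is a
    primitive tending to 0 at infinity. *)
Lemma integral_envelope :
  (\int[leb]_x (envelope alpha x)%:E = (4 * alpha)%:E)%E.
Proof.
rewrite ge0_symfun_integralT; last 3 first.
- by move=> x; rewrite ltW ?envelope_gt0.
- exact: continuous_envelope.
- by move=> x; rewrite /envelope/= normrN.
rewrite -set_itvcy.
pose f x : R := expR (- (x / (2 * alpha))).
pose F x : R := - (2 * alpha) * f x.
have dF (x : R) : is_derive x (1 : R) F (f x).
  have h0 : is_derive x (1 : R) (fun y : R => - (y / (2 * alpha)))
      (- (2 * alpha)^-1).
    have -> : (fun y : R => - (y / (2 * alpha))) =
        ((- (2 * alpha)^-1) *: (id : R -> R)).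
      by apply/funext => y; rewrite fctE /GRing.scale /= mulNr mulrC.
    by apply: is_derive_eq; rewrite /GRing.scale/= mulr1.
  have h1 := @is_derive1_comp _ expR _ _ _ _ (is_derive_expR _) h0.
  have -> : F = (- (2 * alpha)) *: (expR \o (fun y : R => - (y / (2 * alpha)))).
    by [].
  apply: (is_derive_eq (is_deriveZ _ h1)).
  by rewrite /GRing.scale/= /f; field; exact: lt0r_neq0.
have cf : continuous f.
  move=> x; apply: continuous_comp; last exact: continuous_expR.
  apply: (@continuousN _ R); apply: (@continuousM _ R) => //.
  exact: cst_continuous.
have cF : continuous F.
  by move=> x; apply: cvgM; [exact: cst_continuous|exact: cf].
have -> : (\int[leb]_(x in `[0%R, +oo[) (envelope alpha x)%:E =
           \int[leb]_(x in `[0%R, +oo[) (f x)%:E)%E.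
  apply: eq_integral => x; rewrite inE/= in_itv/= andbT => x0.
  by rewrite /envelope ger0_norm.
rewrite (@ge0_continuous_FTC2y _ f F 0 0).
- rewrite /F /f mul0r oppr0 expR0 -EFinB -EFinM; congr EFin; ring.
- by move=> x _; exact: expR_ge0.
- exact: continuous_subspaceT.
- rewrite -[X in _ --> X](mulr0 (- (2 * alpha))).
  apply: cvgMr; rewrite /f.
  apply: (cvg_comp (fun x : R => x / (2 * alpha)) (fun x => expR (- x))).
    apply: gt0_cvgMly; last exact: cvg_id.
    by rewrite invr_gt0 mulr_gt0.
  exact: cvgr_expR.
- by move=> x _; have [] := dF x.
- exact/cvg_at_right_filter/cF.
- by move=> x _; rewrite derive1E; apply: derive_val; exact: dF.
Qed.

End envelope.

(** * Square-integral bounds for translates of the kernel derivatives *)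

Section kernel_L2.
Context {R : realType} (alpha : R) (alpha_gt0 : 0 < alpha).
Notation leb := (@lebesgue_measure R).
Notation E := (envelope alpha).
Notation D := (kernel_deriv alpha).

Let env_translate (a : R) : (\int[leb]_x (E (x - a))%:E = (4 * alpha)%:E)%E.
Proof.
rewrite -(integral_envelope alpha_gt0).
apply: (@ge0_integral_translate _ (EFin \o E)).
- by apply/measurable_EFinP; exact: measurable_envelope.
- by move=> x; rewrite lee_fin ltW// envelope_gt0.
Qed.

Let measurable_env_translate (a : R) :
  measurable_fun [set: measurableTypeR R] (fun x : R => E (x - a)).
Proof.
exact: (measurableT_comp (measurable_envelope alpha) (measurable_translate a)).
Qed.

Lemma measurable_kernel_deriv_translate k (a : R) :
  measurable_fun [set: measurableTypeR R] (fun x : R => D k (x - a)).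
Proof.
exact: (measurableT_comp (measurable_kernel_deriv alpha_gt0 k)
  (measurable_translate a)).
Qed.

(** Since E <= 1, the square of B * E is at most B^2 * E, whose integral does not depend on the
    translation. *)
Lemma kernel_deriv_L2 k : exists2 A, 0 <= A &
  forall a, (\int[leb]_x ((D k (x - a)) ^+ 2)%:E <= A%:E)%E.
Proof.
have [B B0 BE] := kernel_deriv_env alpha_gt0 k.
exists (B ^+ 2 * (4 * alpha)) => [|a].
  by rewrite mulr_ge0 ?sqr_ge0// mulr_ge0// ltW.
rewrite EFinM -(env_translate a) -ge0_integralZl//; last 3 first.
- by apply/measurable_EFinP; exact: measurable_env_translate.
- by move=> x _; rewrite lee_fin ltW// envelope_gt0.
- by rewrite lee_fin sqr_ge0.
apply: ge0_le_integral => //.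
- by move=> x _; rewrite lee_fin sqr_ge0.
- apply/measurable_EFinP; apply: measurable_funX.
  exact: measurable_kernel_deriv_translate.
- apply/measurable_EFinP; apply: measurable_funM => //.
- move=> x _; rewrite -EFinM lee_fin -real_normK ?num_real//.
  have e0 := envelope_gt0 alpha (x - a).
  have e1 := envelope_le1 alpha_gt0 (x - a).
  have := BE (x - a); set e := E _ in e0 e1 *; set d := `|_| => de.
  apply: (@le_trans _ _ ((B * e) ^+ 2)).
    by rewrite ler_sqr ?nnegrE ?normr_ge0// mulr_ge0// ltW.
  by rewrite exprMn ler_wpM2l ?sqr_ge0// expr2 ler_piMr// ltW.
Qed.

Lemma kernel_deriv_sqr_dist k : exists2 C, 0 <= C & forall a b x : R,
  (D k (x - a) - D k (x - b)) ^+ 2 <=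
  C * (`|a - b| * (E (x - a) + E (x - b)) +
       \1_`[Num.min a b, Num.max a b] x).
Proof.
have [B B0 BE] := kernel_deriv_env alpha_gt0 k.
have [L L0 BL] := kernel_deriv_lipschitz alpha_gt0 k.
exists (B * L + (2 * B) ^+ 2) => [|a b x].
  by rewrite addr_ge0 ?sqr_ge0// mulr_ge0.
have ea0 := envelope_gt0 alpha (x - a); have eb0 := envelope_gt0 alpha (x - b).
have ea1 := envelope_le1 alpha_gt0 (x - a).
have eb1 := envelope_le1 alpha_gt0 (x - b).
have da := BE (x - a); have db := BE (x - b).
set ea := E (x - a) in ea0 ea1 da *; set eb := E (x - b) in eb0 eb1 db *.
have dE : `|D k (x - a) - D k (x - b)| <= B * (ea + eb).
  by rewrite (le_trans (ler_normB _ _))// mulrDr lerD.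
rewrite -real_normK ?num_real// expr2.
(* On the same side of 0, one factor of the square is bounded by size and the other by the Lipschitz
   estimate, which yields a single power of |a - b|. *)
have [xab|xab] := eqVneq (0 <= x - a) (0 <= x - b).
- have dL := BL _ _ xab.
  have abE : x - a - (x - b) = b - a by ring.
  rewrite abE (distrC b a) in dL.
  rewrite (le_trans (ler_pM _ _ dE dL))//.
  have -> : B * (ea + eb) * (L * `|a - b|) = B * L * (`|a - b| * (ea + eb)).
    by ring.
  have e0 : 0 <= `|a - b| * (ea + eb) by rewrite mulr_ge0// addr_ge0// ltW.
  rewrite [leRHS]mulrDl ler_wpDr//.
    by rewrite mulr_ge0 ?sqr_ge0// addr_ge0.
  by rewrite ler_wpM2l ?mulr_ge0// lerDl.
(* Opposite sides force x to lie between a and b, so the crude bound (2 B)^2 is charged to the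
   indicator. *)
- have -> : \1_`[Num.min a b, Num.max a b] x = 1 :> R.
    rewrite indicE mem_set//= in_itv/= ge_min le_max.
    move: xab; rewrite !subr_ge0.
    by case: (leP a x) => [_|/ltW ->]; case: (leP b x) => [_|/ltW ->];
      rewrite ?orbT.
  have d2 : `|D k (x - a) - D k (x - b)| <= 2 * B.
    rewrite (le_trans dE)// mulrC ler_wpM2r//.
    by rewrite (_ : 2 = 1 + 1) ?lerD.
  rewrite (le_trans (ler_pM _ _ d2 d2))// -expr2 mulrDr.
  apply: ler_wpDl; last by rewrite mulr1 lerDr mulr_ge0.
  by rewrite mulr_ge0// ?addr_ge0 ?sqr_ge0 ?mulr_ge0// addr_ge0// ltW.
Qed.

Lemma kernel_deriv_L2_translate k : exists2 C, 0 <= C & forall a b : R,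
  (\int[leb]_x ((D k (x - a) - D k (x - b)) ^+ 2)%:E <= (C * `|a - b|)%:E)%E.
Proof.
have [C C0 CE] := kernel_deriv_sqr_dist k.
(* The two envelopes contribute 4 alpha each, and the interval between a and b contributes its
   length |a - b|. *)
exists (C * (8 * alpha + 1)) => [|a b].
  by rewrite mulr_ge0// addr_ge0// mulr_ge0// ltW.
have mI : measurable_fun [set: measurableTypeR R]
    (\1_`[Num.min a b, Num.max a b] : R -> R) by exact: measurable_indic.
have mab : measurable_fun [set: measurableTypeR R]
    (fun x : R => `|a - b| * (E (x - a) + E (x - b)) : R).
  by apply: measurable_funM => //; apply: measurable_funD.
have ab0 (x : R) : 0 <= `|a - b| * (E (x - a) + E (x - b)).
  by rewrite mulr_ge0// addr_ge0// ltW// envelope_gt0.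
apply: (@le_trans _ _ (\int[leb]_x
  (C%:E * ((`|a - b| * (E (x - a) + E (x - b)))%:E +
   (\1_`[Num.min a b, Num.max a b] x)%:E)))%E).
  apply: ge0_le_integral => //.
  - by move=> x _; rewrite lee_fin sqr_ge0.
  - apply/measurable_EFinP; apply: measurable_funX.
    by apply: measurable_funB; exact: measurable_kernel_deriv_translate.
  - apply: emeasurable_funM => //.
    by apply: emeasurable_funD; exact/measurable_EFinP.
  - by move=> x _; rewrite -EFinD -EFinM lee_fin.
rewrite ge0_integralZl//; last 2 first.
- by apply: emeasurable_funD; exact/measurable_EFinP.
- by move=> x _; rewrite -EFinD lee_fin addr_ge0.
rewrite ge0_integralD//;
  do ?[exact/measurable_EFinP | by move=> x _; rewrite lee_fin].
under eq_integral do rewrite EFinM EFinD.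
rewrite ge0_integralZl//; last 2 first.
- by apply: emeasurable_funD; exact/measurable_EFinP.
- by move=> x _; rewrite -EFinD lee_fin addr_ge0// ltW// envelope_gt0.
rewrite ge0_integralD//; do ?[exact/measurable_EFinP |
  by move=> x _; rewrite lee_fin ltW// envelope_gt0].
rewrite !env_translate integral_indic// setIT.
rewrite /= lebesgue_measure_itv/= lte_fin.
have -> : (if (Num.min a b < Num.max a b)%R then
    ((Num.max a b)%:E - (Num.min a b)%:E)%E else 0%E) = `|a - b|%:E.
  case: (ltgtP a b) => [ab|ab|->]; rewrite ?subrr ?normr0//.
  - by rewrite ab -EFinB distrC gtr0_norm ?subr_gt0.
  - by rewrite ab -EFinB gtr0_norm ?subr_gt0.
  - by rewrite ltxx.
rewrite lee_fin.
rewrite le_eqVlt; apply/orP; left; apply/eqP; ring.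
Qed.

End kernel_L2.

Lemma integrable_mul_bounded d (T : measurableType d) (R : realType)
    (m : {measure set T -> \bar R}) (f g : T -> R) (B : R) :
  measurable_fun setT f -> (forall x, `|f x| <= B) ->
  m.-integrable setT (EFin \o g) ->
  m.-integrable setT (EFin \o (fun x => f x * g x)).
Proof.
move=> mf fB ig.
have mg : measurable_fun setT g by exact/measurable_EFinP/measurable_int/ig.
apply: (@le_integrable _ _ _ m _ measurableT _
  (fun x => B%:E * (EFin \o g) x)%E).
- by apply/measurable_EFinP; exact: measurable_funM.
- move=> x _ /=; rewrite lee_fin !normrM.
  by rewrite ler_wpM2r// (le_trans (fB x)) ?ler_norm.
- exact: integrableZl.
Qed.

(** * Support and integrability of test functions *)

Section test_functions.
Context {R : realType}.
Notation leb := (@lebesgue_measure R).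
Implicit Types phi : R -> R.

(** A single M serves all orders: phi vanishes on the open set N < |y|, hence so do all its
    derivatives. *)
Lemma test_function_support phi : test_function phi ->
  exists2 M, 0 < M & forall n x, M < `|x| -> derive1n n phi x = 0.
Proof.
move=> [_ /compact_bounded[M [_ MB]]].
(* Boundedness only says that every number above M is a bound, and M may be negative; N is positive
   and exceeds M. *)
pose N := `|M| + 1.
have N0 : 0 < N by rewrite ltr_wpDl.
exists N => // n x Nx.
have d0 : derive1n n (cst 0 : R -> R) = cst 0.
  elim: n => [//|n IH]; rewrite derive1nS IH.
  by apply/funext => y; rewrite derive1_cst.
have oN : open [set y : R | N < `|y|].
  apply: (@open_comp _ _ (Num.norm : R -> R) [set y : R | N < y]) => [y _|].
    exact: norm_continuous.
  exact: open_gt.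
rewrite (@eq_derive1n _ [set y | N < `|y|] _ (cst 0)) ?d0//.
- move=> y /= Ny; apply: contrapT => /eqP y0.
  have cy : closure [set x | phi x != 0] y by exact: subset_closure.
  have /(_ cy) /= := MB N (ltr_pwDr ltr01 (ler_norm M)) y.
  by rewrite leNgt Ny.
Qed.

Lemma continuous_test_function phi n : test_function phi ->
  continuous (derive1n n phi).
Proof.
by move=> [dphi _] x; apply/differentiable_continuous/derivable1_diffP/dphi.
Qed.

Lemma is_derive_test_function phi n x : test_function phi ->
  is_derive x (1 : R) (derive1n n phi) (derive1n n.+1 phi x).
Proof.
move=> [dphi _]; rewrite derive1nS derive1E.
by apply: DeriveDef => //; exact: dphi.
Qed.

Lemma integrable_test_function phi n : test_function phi ->
  leb.-integrable setT (EFin \o derive1n n phi).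
Proof.
move=> tphi; have [M M0 phiM] := test_function_support tphi.
have -> : derive1n n phi = derive1n n phi \_ `[-M, M].
  apply/funext => x; rewrite patchE; case: ifPn => //.
  rewrite notin_setE/= in_itv/= -ler_norml => /negP; rewrite -ltNge.
  exact: phiM.
rewrite -restrict_EFin; apply: (integrable_mkcond _ _).1 => //.
apply: continuous_compact_integrable; first exact: segment_compact.
exact/continuous_subspaceT/continuous_test_function.
Qed.

End test_functions.

(** * Weak derivatives of translates of the kernel *)

Section weak_derivatives.
Context {R : realType}.
Notation leb := (@lebesgue_measure R).

Lemma continuous_is_derive (f df : R -> R) :
  (forall x, is_derive x (1 : R) f (df x)) -> continuous f.
Proof.
move=> fdf x; apply/differentiable_continuous/derivable1_diffP.
by have [] := fdf x.
Qed.

Lemma integral_is_derive (F f : R -> R) (u v : R) : u < v ->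
  (forall x, is_derive x (1 : R) F (f x)) -> continuous f ->
  (\int[leb]_(x in `[u, v]) (f x)%:E = (F v - F u)%:E)%E.
Proof.
move=> uv Ff cf; have cF := continuous_is_derive Ff.
rewrite (@continuous_FTC2 _ f F)//.
- exact: continuous_subspaceT.
- split.
  + by move=> x _; have [] := Ff x.
  + exact/cvg_at_right_filter/cF.
  + exact/cvg_at_left_filter/cF.
- by move=> x _; rewrite derive1E; apply: derive_val; exact: Ff.
Qed.

(** The fundamental theorem of calculus is applied on each side of a. F and G need not agree at a,
    so a jump would show up in the result. *)
Lemma Rintegral_piecewise_is_derive (F G f g : R -> R) (u a v : R) :
  u < a -> a < v ->
  (forall x, is_derive x (1 : R) F (f x)) -> continuous f ->
  (forall x, is_derive x (1 : R) G (g x)) -> continuous g ->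
  \int[leb]_(x in `[u, v]) (if x < a then f x else g x) =
  F a - F u + (G v - G a).
Proof.
move=> ua av Ff cf Gg cg; rewrite /Rintegral.
have mf : measurable_fun [set: measurableTypeR R] f.
  exact: continuous_measurable_fun.
have mg : measurable_fun [set: measurableTypeR R] g.
  exact: continuous_measurable_fun.
have mh : measurable_fun [set: measurableTypeR R]
    (fun x => if x < a then f x else g x).
  by apply: measurable_fun_ifT => //; exact: measurable_fun_ltr.
have -> : `[u, v]%classic = `[u, a[%classic `|` `[a, v]%classic :> set R.
  by apply: itv_bndbnd_setU; rewrite bnd_simp ltW.
rewrite integral_setU//=; last 2 first.
- exact/measurable_EFinP/measurable_funTS.
- apply/disj_setPS => x [/=]; rewrite !in_itv/= => /andP[_ xa] /andP[].
  by rewrite leNgt xa.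
rewrite (_ : \int[leb]_(x in `[u, a[) _ = (F a - F u)%:E)%E; last first.
  rewrite -(integral_is_derive ua Ff cf) -integral_itv_bndo_bndc; last first.
    exact/measurable_EFinP/measurable_funTS.
  by apply: eq_integral => x; rewrite inE/= in_itv/= => /andP[_ ->].
rewrite (_ : \int[leb]_(x in `[a, v]) _ = (G v - G a)%:E)%E//.
rewrite -(integral_is_derive av Gg cg).
by apply: eq_integral => x; rewrite inE/= in_itv/= ltNge => /andP[->].
Qed.


Variables (alpha : R) (alpha_gt0 : 0 < alpha).
Notation D := (kernel_deriv alpha).
Implicit Types (phi : R -> R) (a : R).

(** Using one branch of the kernel on the whole line makes this product differentiable everywhere,
    including at a. *)
Let branch s k a phi n (x : R) :=
  expoly alpha s (expoly_coef alpha s k) (x - a) * derive1n n phi x.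

Let is_derive_branch s k a phi n x : test_function phi ->
  is_derive x (1 : R) (branch s k a phi n)
    (branch s k a phi n.+1 x + branch s k.+1 a phi n x).
Proof.
move=> tphi.
have h0 : is_derive x (1 : R) (fun y : R => y - a) 1.
  have -> : (fun y : R => y - a) = (id : R -> R) - cst a by [].
  by apply: is_derive_eq; rewrite subr0.
have h1 := @is_derive1_comp _ _ (fun y : R => y - a) x _ _
  (is_derive_expoly alpha_gt0 s (expoly_coef alpha s k) (x - a)) h0.
have h2 := is_derive_test_function n x tphi.
apply: (is_derive_eq (is_deriveM h1 h2)).
by rewrite /GRing.scale/= mulr1 /branch; congr (_ + _); exact: mulrC.
Qed.

Let continuous_branch s k a phi n : test_function phi ->
  continuous (branch s k a phi n).
Proof.
move=> tphi.
exact: (continuous_is_derive (fun x => is_derive_branch s k a n x tphi)).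
Qed.

Lemma integrable_kernel_deriv_test k a phi n : test_function phi ->
  leb.-integrable setT (EFin \o (fun x => D k (x - a) * derive1n n phi x)).
Proof.
move=> tphi; have [B B0 BE] := kernel_deriv_env alpha_gt0 k.
apply: (@integrable_mul_bounded _ _ _ _ _ _ B).
- exact: measurable_kernel_deriv_translate.
- by move=> x; rewrite (le_trans (BE _))// ler_piMr// envelope_le1.
- exact: integrable_test_function.
Qed.

(** The sum of the two integrands is the derivative of a product on each side of a. The boundary
    terms at a cancel because K^(k) is continuous at 0 for k < 3, and those far out vanish. *)
Lemma kernel_deriv_by_parts k a phi n : (k < 3)%N -> test_function phi ->
  \int[leb]_x (D k (x - a) * derive1n n.+1 phi x) =
  - \int[leb]_x (D k.+1 (x - a) * derive1n n phi x).
Proof.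
move=> k3 tphi; apply/eqP; rewrite -addr_eq0 -RintegralD//;
  do ?exact: integrable_kernel_deriv_test.
have [M M0 phiM] := test_function_support tphi.
(* This places a strictly inside [-N, N] and makes phi and its derivatives vanish at and beyond the
   endpoints. *)
pose N := M + `|a| + 1.
have [Na aN] : - N < a /\ a < N.
  by apply/andP; rewrite -ltr_norml /N; lra.
have MN : M < N by rewrite /N; have := normr_ge0 a; lra.
have phiN m x : N <= `|x| -> derive1n m phi x = 0.
  by move=> Nx; apply: phiM; exact: lt_le_trans Nx.
pose f s x := branch s k a phi n.+1 x + branch s k.+1 a phi n x.
pose h x := if x < a then f (-1) x else f 1 x.
have hE x : D k (x - a) * derive1n n.+1 phi x +
    D k.+1 (x - a) * derive1n n phi x = h x.
  by rewrite /h /f /branch /kernel_deriv subr_ge0 ltNge; case: ifPn.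
have -> : \int[leb]_x (D k (x - a) * derive1n n.+1 phi x +
    D k.+1 (x - a) * derive1n n phi x) = \int[leb]_(x in `[-N, N]) h x.
  rewrite [RHS]Rintegral_mkcond; apply: eq_Rintegral => x _.
  rewrite hE patchE; case: ifPn => //.
  rewrite notin_setE/= in_itv/= -ler_norml => /negP; rewrite -ltNge => /ltW xN.
  by rewrite /h /f /branch !phiN// !mulr0 addr0 if_same.
have cf s : continuous (f s).
  by move=> x; apply: cvgD; exact: continuous_branch.
rewrite (Rintegral_piecewise_is_derive Na aN
  (fun x => is_derive_branch (-1) k a n x tphi) (cf (-1))
  (fun x => is_derive_branch 1 k a n x tphi) (cf 1)).
apply/eqP; rewrite /branch subrr -(kernel_deriv_cont0 alpha_gt0 k3).
rewrite (phiN _ N) ?ler_norm// (phiN _ (- N)) ?normrN ?ler_norm// !mulr0.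
by rewrite subr0 sub0r subrr.
Qed.

Lemma kernel_deriv_weak k a phi : (k <= 3)%N -> test_function phi ->
  \int[leb]_x (D 0 (x - a) * derive1n k phi x) =
  (-1) ^+ k * \int[leb]_x (D k (x - a) * phi x).
Proof.
move=> k3 tphi.
(* Each integration by parts raises the order on the kernel, so the induction needs an arbitrary
   initial order j. *)
suff H j : (j + k <= 3)%N -> \int[leb]_x (D j (x - a) * derive1n k phi x) =
    (-1) ^+ k * \int[leb]_x (D (j + k) (x - a) * phi x) by exact: H.
elim: k j {k3} => [|k IH] j jk; first by rewrite expr0 mul1r addn0.
rewrite kernel_deriv_by_parts ?IH ?addnS ?addSn//.
- by rewrite exprS mulN1r mulNr.
- by move: jk; rewrite addnS.
- by rewrite (leq_trans _ jk)// addnS ltnS leq_addr.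
Qed.

End weak_derivatives.

(** * L^2 norms and superpositions against a finite measure *)

Lemma Lfun2_sqr_le (R : realType) (g : R -> R) (A : R) :
  measurable_fun [set: measurableTypeR R] g ->
  (\int[@lebesgue_measure R]_x (g x ^+ 2)%:E <= A%:E)%E ->
  g \in Lfun (@lebesgue_measure R) 2%:E /\
  fine ('N[@lebesgue_measure R]_2%:E[EFin \o g])%E ^+ 2 <= A.
Proof.
move=> mg gA.
have N0 : (0 <= 'N[@lebesgue_measure R]_2%:E[EFin \o g])%E by exact: Lnorm_ge0.
have NA : ('N[@lebesgue_measure R]_2%:E[EFin \o g] `^ 2 <= A%:E)%E.
  rewrite poweR_Lnorm ?pnatr_eq0//.
  rewrite (eq_integral (fun x : measurableTypeR R => (g x ^+ 2)%:E))// => x _.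
  by rewrite /= powR_mulrn// real_normK ?num_real.
(* Finiteness is settled first, because [fine] would send an infinite norm to 0. *)
have Nfin : 'N[@lebesgue_measure R]_2%:E[EFin \o g]%E \is a fin_num.
  rewrite ge0_fin_numE// ltNge leye_eq; apply/eqP => Ny.
  by move: NA; rewrite Ny poweRyr ?pnatr_eq0.
split.
  apply/andP; split; first exact/mem_set.
  by apply/mem_set; rewrite /= /finite_norm -ge0_fin_numE.
by rewrite -powR_mulrn ?fine_ge0// -lee_fin -poweR_EFin fineK.
Qed.

Section superposition.
Context d (T : measurableType d) (R : realType).
Variables (m : {finite_measure set T -> \bar R}) (m_le1 : (m setT <= 1)%E).
Notation leb := (@lebesgue_measure R).

Lemma integrable_bounded (f : T -> R) (B : R) : measurable_fun setT f ->
  (forall z, `|f z| <= B) -> m.-integrable setT (EFin \o f).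
Proof.
move=> mf fB; apply: (@le_integrable _ _ _ m _ measurableT _ (EFin \o cst B)).
- exact/measurable_EFinP.
- by move=> z _; rewrite /= lee_fin (le_trans (fB z)) ?ler_norm.
- exact: finite_measure_integrable_cst.
Qed.

Let m1 : fine (m setT) <= 1.
Proof.
by rewrite -lee_fin fineK// fin_num_measure.
Qed.

Lemma normr_Rintegral_bounded (f : T -> R) (B : R) : measurable_fun setT f ->
  (forall z, `|f z| <= B) -> 0 <= B -> `|\int[m]_z f z| <= B.
Proof.
move=> mf fB B0; have fi := integrable_bounded mf fB.
rewrite (le_trans (le_normr_Rintegral _ _))//.
apply: (@le_trans _ _ (\int[m]_z B)); last first.
  by rewrite Rintegral_cst// ler_piMr.
apply: le_Rintegral => //.
- apply: (@integrable_bounded _ B); first exact: measurableT_comp.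
  by move=> z; rewrite normr_id.
- exact: finite_measure_integrable_cst.
Qed.

(* Integrate 2 c f <= f^2 + c^2 with c the mean of f. *)
Lemma sqr_Rintegral_le (f : T -> R) (B : R) : measurable_fun setT f ->
  (forall z, `|f z| <= B) ->
  (((\int[m]_z f z) ^+ 2)%:E <= \int[m]_z (f z ^+ 2)%:E)%E.
Proof.
move=> mf fB; have fi := integrable_bounded mf fB.
have f2i : m.-integrable setT (EFin \o (fun z => f z ^+ 2)).
  apply: (@integrable_bounded _ (B ^+ 2)); first exact: measurable_funX.
  move=> z; rewrite normrX; have := fB z; have := normr_ge0 (f z); nra.
set c := \int[m]_z f z.
have ci : m.-integrable setT (EFin \o (fun=> c ^+ 2)).
  exact: finite_measure_integrable_cst.
have : \int[m]_z (2 * c * f z) <= \int[m]_z (f z ^+ 2 + c ^+ 2).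
  apply: le_Rintegral => //.
  - exact: (@integrableZl _ _ _ m _ measurableT (2 * c) (EFin \o f)).
  - exact: (@integrableD _ _ _ m _ measurableT _ _ f2i ci).
  - by move=> z _; have := sqr_ge0 (f z - c); nra.
rewrite RintegralZl// RintegralD// Rintegral_cst// -/c => h.
rewrite -[leRHS]fineK; last exact: integrable_fin_num.
(* Mass at most 1 lets c^2 absorb the integral of the constant c^2, so 2 c^2 <= int f^2 + c^2 m(T)
   leaves c^2 <= int f^2. *)
have c1 : c ^+ 2 * fine (m setT) <= c ^+ 2 by rewrite ler_piMr ?sqr_ge0.
have : c ^+ 2 <= \int[m]_z (f z ^+ 2) by move: h c1; rewrite expr2; lra.
by rewrite -lee_fin.
Qed.

Variables (F : R -> T -> R) (B : R).
Hypothesis mF :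
  measurable_fun [set: measurableTypeR R * T] (fun p => F p.1 p.2).
Hypothesis FB : forall x z, `|F x z| <= B.
Let g x := \int[m]_z F x z.

Let B0 : 0 <= B.
Proof. exact: le_trans (FB 0 point). Qed.

Let mFz x : measurable_fun setT (F x).
Proof.
exact: (measurableT_comp mF (measurable_pair1 x)).
Qed.

Let mFx z : measurable_fun [set: measurableTypeR R] (F^~ z).
Proof.
exact: (measurableT_comp mF (measurable_pair2 z)).
Qed.

(** A bounded F need not be integrable on the product with Lebesgue measure, so the positive and
    negative parts are treated separately by Tonelli. *)
Lemma measurable_superposition : measurable_fun [set: measurableTypeR R] g.
Proof.
rewrite /g /Rintegral.
apply: (measurableT_comp (@fine_measurable R setT measurableT)).
under eq_fun do rewrite integralE.
have mE : measurable_fun [set: measurableTypeR R * T] (fun p => (F p.1 p.2)%:E).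
  exact/measurable_EFinP.
apply: emeasurable_funB.
- apply: eq_measurable_fun (@measurable_fun_fubini_tonelli_F _ _
    (measurableTypeR R) T R m _ (measurable_funepos mE) (funepos_ge0 _)).
  by move=> x _; apply: eq_integral => z _; rewrite !funeposE.
- apply: eq_measurable_fun (@measurable_fun_fubini_tonelli_F _ _
    (measurableTypeR R) T R m _ (measurable_funeneg mE) (funeneg_ge0 _)).
  by move=> x _; apply: eq_integral => z _; rewrite !funenegE.
Qed.

Lemma superposition_L2 (A : R) :
  (forall z, \int[leb]_x (F x z ^+ 2)%:E <= A%:E)%E ->
  (\int[leb]_x (g x ^+ 2)%:E <= A%:E)%E.
Proof.
move=> FA.
have mF2 : measurable_fun [set: measurableTypeR R * T]
    (fun p => (F p.1 p.2 ^+ 2)%:E).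
  by apply/measurable_EFinP; exact: measurable_funX.
have F20 p : (0 <= (F p.1 p.2 ^+ 2)%:E)%E by rewrite lee_fin sqr_ge0.
apply: (@le_trans _ _ (\int[leb]_x \int[m]_z (F x z ^+ 2)%:E)%E).
  apply: ge0_le_integral => //.
  - by move=> x _; rewrite lee_fin sqr_ge0.
  - apply/measurable_EFinP; apply: measurable_funX.
    exact: measurable_superposition.
  - exact: (@measurable_fun_fubini_tonelli_F _ _ (measurableTypeR R) T R m _
      mF2 F20).
  - move=> x _; exact: (sqr_Rintegral_le (mFz x) (FB x)).
rewrite (@fubini_tonelli _ _ (measurableTypeR R) T R leb m _ mF2 F20).
apply: (@le_trans _ _ (\int[m]_z A%:E)%E).
  apply: ge0_le_integral => //.
  - by move=> z _; apply: integral_ge0 => x _; rewrite lee_fin sqr_ge0.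
  - exact: (@measurable_fun_fubini_tonelli_G _ _ (measurableTypeR R) T R leb _
      mF2 F20).
  - by move=> z _; exact: FA.
rewrite integral_cst//.
(* The sign of A is read off the hypothesis at the default element of T; it is needed to multiply by
   the mass bound. *)
have A0 : 0 <= A.
  rewrite -lee_fin (le_trans _ (FA point))//.
  by apply: integral_ge0 => x _; rewrite lee_fin sqr_ge0.
by rewrite -[leRHS]mule1 lee_wpmul2l// lee_fin.
Qed.

Lemma locally_integrable_superposition : locally_integrable setT g.
Proof.
split; [exact: measurable_superposition|exact: openT|move=> K _ cK].
have mK : measurable K by exact: compact_measurable.
have : leb.-integrable K (EFin \o g).
  apply: measurable_bounded_integrable => //.
  - exact: compact_finite_measure.
  - by apply: measurable_funTS; exact: measurable_superposition.
  - exists B; split; first exact: num_real.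
    move=> y By x _; apply: le_trans (ltW By).
    exact: normr_Rintegral_bounded.
by move=> /integrableP[].
Qed.

(** The integrable weight psi restores integrability on the product: |F psi| <= B |psi| and m has
    mass at most 1. *)
Lemma superposition_Fubini (psi : R -> R) :
  leb.-integrable setT (EFin \o psi) ->
  \int[leb]_x (g x * psi x) = \int[m]_z \int[leb]_x (F x z * psi x).
Proof.
move=> ipsi.
have mpsi : measurable_fun [set: measurableTypeR R] psi.
  by apply/measurable_EFinP; exact: measurable_int ipsi.
pose f (p : measurableTypeR R * T) : \bar R := (F p.1 p.2 * psi p.1)%:E.
have mf : measurable_fun setT f.
  apply/measurable_EFinP; apply: measurable_funM => //.
  exact: measurableT_comp.
have fi : (leb \x m)%E.-integrable setT f.
  apply/integrable12ltyP => //.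
  apply: (@le_lt_trans _ _ (\int[leb]_x (B%:E * `|(psi x)%:E|))%E).
    apply: ge0_le_integral => //.
    - by move=> x _; exact: integral_ge0.
    - exact: (@measurable_fun_fubini_tonelli_F _ _ (measurableTypeR R) T R m
        (abse \o f) (measurableT_comp (@abse_measurable _ _) mf)
        (fun=> abse_ge0 _)).
    - apply: emeasurable_funM => //; apply: measurableT_comp => //.
      exact/measurable_EFinP.
    - move=> x _.
      apply: (@le_trans _ _ (\int[m]_z (B * `|psi x|)%:E)%E).
        apply: ge0_le_integral => //.
        + apply: measurableT_comp => //; apply/measurable_EFinP.
          by apply: measurable_funM => /=; [exact: mFz|exact: measurable_cst].
        + by move=> z _; rewrite /f/= lee_fin normrM ler_wpM2r.
      rewrite integral_cst// -[leRHS]mule1.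
      by rewrite lee_wpmul2l// lee_fin mulr_ge0.
  rewrite ge0_integralZl//; last first.
    by apply: measurableT_comp => //; exact/measurable_EFinP.
  by move/integrableP : ipsi => [_]; apply: lte_mul_pinfty.
have fF x : (\int[m]_z f (x, z))%E = (g x * psi x)%:E.
  rewrite -RintegralZr//; last exact: integrable_bounded (mFz x) (FB x).
  rewrite /Rintegral fineK//; apply: integrable_fin_num => //.
  exact: (integrable_mul_bounded (mFz x) (FB x)
    (finite_measure_integrable_cst m (psi x) measurableT)).
rewrite /Rintegral -(eq_integral _ _ (fun x _ => fF x)).
rewrite (Fubini fi); congr fine; apply: eq_integral => z _.
rewrite fineK//; apply: integrable_fin_num => //.
exact: (integrable_mul_bounded (mFx z) (FB^~ z)).
Qed.

End superposition.

(** * Sobolev bounds for superpositions, with auxiliary facts *)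

Lemma sobolev_superposition d (T : measurableType d) (R : realType)
    (m : {finite_measure set T -> \bar R}) (n : nat) (F : nat -> R -> T -> R)
    (A : R) : (m setT <= 1)%E ->
  (forall k, (k <= n)%N ->
    measurable_fun [set: measurableTypeR R * T] (fun p => F k p.1 p.2)) ->
  (forall k, (k <= n)%N -> exists B, forall x z, `|F k x z| <= B) ->
  (forall k z, (k <= n)%N ->
    \int[@lebesgue_measure R]_x (F k x z ^+ 2)%:E <= A%:E)%E ->
  (forall k z phi, (k <= n)%N -> test_function phi ->
    \int[@lebesgue_measure R]_x (F 0%N x z * derive1n k phi x) =
    (-1) ^+ k * \int[@lebesgue_measure R]_x (F k x z * phi x)) ->
  sobolev n (fun x => \int[m]_z F 0%N x z) /\
  (sobolev_norm n (fun x => \int[m]_z F 0%N x z)%R <=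
    (Num.sqrt (n.+1%:R * A))%:E)%E.
Proof.
move=> m1 mF FB FA Fweak.
have mFx k z : (k <= n)%N -> measurable_fun [set: measurableTypeR R] (F k ^~ z).
  by move=> kn; exact: (measurableT_comp (mF k kn) (measurable_pair2 z)).
pose g k x := \int[m]_z F k x z.
have gL k : (k <= n)%N -> g k \in Lfun (@lebesgue_measure R) 2%:E /\
    fine ('N[@lebesgue_measure R]_2%:E[EFin \o g k])%E ^+ 2 <= A.
  move=> kn; have [B kB] := FB k kn; apply: Lfun2_sqr_le.
    exact: (measurable_superposition m (mF k kn)).
  by apply: (superposition_L2 m1 (mF k kn) kB) => z; exact: FA.
have sg : sobolev_derivs n (g 0%N) g.
  split => // k kn; split; first by have [] := gL k kn.
  have [B kB] := FB k kn; have [B' B'0] := FB 0%N (leq0n n).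
  split.
  - exact: (locally_integrable_superposition m1 (mF 0%N (leq0n n)) B'0).
  - exact: (locally_integrable_superposition m1 (mF k kn) kB).
  - move=> phi tphi.
    have iphi := integrable_test_function 0 tphi.
    rewrite (superposition_Fubini m1 (mF 0%N (leq0n n)) B'0)//; last first.
      exact: integrable_test_function.
    have igphi : (@lebesgue_measure R).-integrable setT
        (EFin \o (fun x => g k x * phi x)).
      apply: integrable_mul_bounded iphi.
        exact: (measurable_superposition m (mF k kn)).
      move=> x; apply: (normr_Rintegral_bounded m1) => [|z|].
      + exact: (measurableT_comp (mF k kn) (measurable_pair1 x)).
      + exact: kB.
      + exact: le_trans (kB x point).
    (* The sign (-1)^k is moved onto phi, so that Fubini applies with the weight (-1)^k phi. *)
    rewrite -RintegralZl//.
    under [RHS]eq_Rintegral do rewrite mulrCA.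
    rewrite (superposition_Fubini m1 (mF k kn) kB); last first.
      exact: (integrableZl measurableT _ iphi).
    apply: eq_Rintegral => z _; rewrite Fweak// -RintegralZl//.
      by apply: eq_Rintegral => x _; rewrite mulrCA.
    exact: (integrable_mul_bounded (mFx k z kn) (kB^~ z) iphi).
split; first by exists g.
(* The family g is one competitor in the infimum; each of its n + 1 squared norms is at most A. *)
apply: (@le_trans _ _ (Num.sqrt (\sum_(k < n.+1)
  fine ('N[@lebesgue_measure R]_2%:E[EFin \o g k])%E ^+ 2))%:E).
  by apply: ereal_inf_lbound; exists g.
rewrite lee_fin ler_wsqrtr// -[n.+1 in leRHS]card_ord -sumr_const mulr_suml.
by apply: ler_sum => k _; rewrite mul1r; have [] := gL k (ltn_ord k).
Qed.

(** Merges the constants found for each order of differentiation into one, by adding them up. *)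
Lemma uniform_bound (R : realDomainType) (n : nat) (P : nat -> R -> Prop) :
  (forall k, exists2 A, 0 <= A & P k A) ->
  (forall k A A', A <= A' -> P k A -> P k A') ->
  exists2 A, 0 <= A & forall k, (k <= n)%N -> P k A.
Proof.
move=> PA Pmono; elim: n => [|n [A A0 IH]].
  by have [A A0 PA0] := PA 0%N; exists A => // k; rewrite leqn0 => /eqP ->.
have [A' A'0 PA'] := PA n.+1; exists (A + A') => [|k]; first exact: addr_ge0.
rewrite leq_eqVlt => /predU1P[->|kn].
  by apply: Pmono PA'; rewrite lerDr.
by apply: Pmono (IH k kn); rewrite lerDl.
Qed.

Lemma tv_norm_ge_setT (R : realType) (mu : {finite_measure set R -> \bar R}) :
  (mu setT <= tv_norm mu)%E.
Proof.
rewrite -[leLHS]gee0_abs//; apply: ereal_sup_ubound; exists 1%N.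
exists (fun i => if i == 0%N then setT else set0); split.
- by move=> i; case: ifPn.
- by move=> [|i] [|j] _ _ //= [x []].
- by rewrite big_ord1.
Qed.

(** The equation holds for t > 0 only, so continuity at the initial time comes from the one-sided
    derivative: the difference quotient times s tends to 0. *)
Lemma deriv_on_cvg_at_right0 (R : realType) (f : R -> R) (l : R) :
  deriv_on Rnneg f 0 l -> f s @[s --> 0^'+] --> f 0.
Proof.
rewrite /deriv_on => fl.
have h : (f s - f 0) / (s - 0) * s @[s --> 0^'+] --> l * 0.
  apply: cvgM; last exact: cvg_at_right_filter cvg_id.
  apply: cvg_trans fl; apply: cvg_app => P H.
  have {}H : nbhs (0 : R) [set s | s != 0 -> Rnneg s -> P s] := H.
  apply: filterS H => s H s0; apply: H; first by rewrite gt_eqF.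
  exact: ltW.
have {h} : (f s - f 0) / (s - 0) * s + f 0 @[s --> 0^'+] --> l * 0 + f 0.
  by apply: cvgD h _; exact: cvg_cst.
rewrite mulr0 add0r; apply: cvg_trans; apply: near_eq_cvg; near=> s.
have s0 : 0 < s by near: s; exact: nbhs_right_gt.
by rewrite subr0 divfK ?subrK// gt_eqF.
Unshelve. all: by end_near. Qed.

(** * Lipschitz bounds in time for c and Sobolev bounds for [hbar] *)

Section solution.
Context {R : realType} (alpha : R) (alpha_gt0 : 0 < alpha).
Variables (mu : {finite_measure set R -> \bar R}) (mu_le1 : (mu setT <= 1)%E).
Variables (c : R -> R -> R) (cI : class_I c) (c_sol : is_solution alpha mu c).
Notation D := (kernel_deriv alpha).

Let mc t : 0 <= t -> measurable_fun setT (c^~ t).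
Proof. by have [_ mc _ _] := cI; exact: mc. Qed.

Let c_inj t x y : 0 <= t -> x != y -> c x t - c y t != 0.
Proof.
have [_ _ _ cmono] := cI => t0; rewrite subr_eq0 neq_lt => /orP[]xy.
  by rewrite lt_eqF// cmono.
by rewrite gt_eqF// cmono.
Qed.

Let mD k x t : 0 <= t -> measurable_fun setT (fun z => D k (x - c z t)).
Proof.
move=> t0; apply: (measurableT_comp (measurable_kernel_deriv alpha_gt0 k)).
by apply: measurable_funB => //; exact: mc.
Qed.

(** H is bounded by sup |K| and the other factor by sup |K'''|, as mu has mass at most 1. Strict
    monotonicity of c(., t) keeps the argument of K''' away from 0. *)
Lemma speed_bounded : exists2 L, 0 <= L & forall x t, 0 < t ->
  `|Hfun alpha mu c x t ^+ 2 *
    \int[mu]_(z in [set z | z != x]) derive1n 3 (kernelK alpha) (c x t - c z t)|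
  <= L.
Proof.
have [B0 HB0] := kernel_deriv_bounded alpha_gt0 0.
have [B3 HB3] := kernel_deriv_bounded alpha_gt0 3.
have B0ge := le_trans (normr_ge0 _) (HB0 0).
have B3ge := le_trans (normr_ge0 _) (HB3 0).
exists (B0 ^+ 2 * B3) => [|x t t0]; first by rewrite mulr_ge0// sqr_ge0.
rewrite normrM normrX ler_pM ?exprn_ge0//.
- rewrite ler_sqr ?nnegrE// /Hfun -(kernel_deriv0 alpha_gt0).
  apply: (normr_Rintegral_bounded mu_le1) => //.
  exact: mD (ltW t0).
- rewrite (@eq_Rintegral _ _ _ mu _ (fun z => D 3 (c x t - c z t))); last first.
    move=> z /set_mem/eqP zx; rewrite derive1n_kernelK//.
    by apply: c_inj; [exact: ltW|rewrite eq_sym; exact/eqP].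
  rewrite Rintegral_mkcond; apply: (normr_Rintegral_bounded mu_le1) => //.
    have -> : [set z | z != x] = ~` [set x].
      by apply/seteqP; split => z /= /eqP.
    apply: (measurable_restrictT _ _).1; first exact: measurableC.
    by apply: measurable_funTS; apply: mD; exact: ltW.
  by move=> z; rewrite patchE; case: ifPn => //; rewrite normr0.
Qed.

Lemma solution_lipschitz : exists2 L, 0 <= L & forall x s t, 0 <= s -> 0 <= t ->
  `|c x s - c x t| <= L * `|s - t|.
Proof.
have [L L0 HL] := speed_bounded; exists L => // x.
suff H s t : 0 <= s -> s < t -> `|c x t - c x s| <= L * `|t - s|.
  move=> s t s0 t0; case: (ltgtP s t) => [st|st|->].
  - by rewrite distrC (distrC s); exact: H.
  - exact: H.
  - by rewrite !subrr normr0 mulr0.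
move=> s0 st.
have [_ cder] := c_sol.
have [_ _ C1 _] := cI.
have cc u : 0 < u -> {for u, continuous (c x)}.
  move=> u0; apply/differentiable_continuous/derivable1_diffP.
  by have [] := cder x u u0.
have cw : {within `[s, t], continuous (c x)}.
  apply: derivable_oo_LRcontinuous_within; split.
  - move=> u; rewrite in_itv/= => /andP[su _].
    by have [] := cder x u (le_lt_trans s0 su).
  (* For s = 0 right-continuity comes from the C^1 condition in [class_I], for s > 0 from the
     equation. *)
  - have := s0; rewrite le_eqVlt => /predU1P[<-|s_gt0].
    + have [dc [dcP _]] := C1 x.
      exact: deriv_on_cvg_at_right0 (dcP 0 (lexx 0)).
    + exact/cvg_at_right_filter/cc.
  - exact/cvg_at_left_filter/cc/(le_lt_trans s0).
have u_gt0 u : u \in `]s, t[ -> 0 < u.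
  by rewrite in_itv/= => /andP[su _]; exact: le_lt_trans su.
have [u uin ->] := MVT st (fun u uin => cder x u (u_gt0 u uin)) cw.
by rewrite normrM ler_wpM2r// HL// u_gt0.
Qed.

(** Change of variables in its nonnegative form, available because K >= 0, exhibits [hbar] as a
    superposition of translates. *)
Lemma hbarE t : 0 <= t ->
  hbar alpha mu c t = fun x => \int[mu]_z D 0 (x - c z t).
Proof.
move=> t0; apply/funext => x.
rewrite /hbar /convolution /hmeas /Rintegral (kernel_deriv0 alpha_gt0).
congr fine.
rewrite ge0_integral_pushforward//.
- exact: mc.
- apply/measurable_EFinP; rewrite -(kernel_deriv0 alpha_gt0).
  apply: (measurableT_comp (measurable_kernel_deriv alpha_gt0 0)).
  exact: measurable_funB.
- move=> y _; rewrite lee_fin /kernelK.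
  rewrite !mulr_ge0 ?expR_ge0// ?addr_ge0 ?invr_ge0//.
    by rewrite mulr_ge0// sqr_ge0.
  exact: ltW.
Qed.

Let mD2 k t : 0 <= t -> measurable_fun [set: measurableTypeR R * R]
  (fun p : measurableTypeR R * R => D k (p.1 - c p.2 t)).
Proof.
move=> t0; apply: (measurableT_comp (measurable_kernel_deriv alpha_gt0 k)).
apply: measurable_funB; first exact: measurable_fst.
exact: (measurableT_comp (mc t0) measurable_snd).
Qed.

Lemma hbar_sobolev_bounded : exists A, forall t, 0 <= t ->
  sobolev 3 (hbar alpha mu c t) /\
  (sobolev_norm 3 (hbar alpha mu c t) <= A%:E)%E.
Proof.
have [A A0 DA] := @uniform_bound _ 3 _ (kernel_deriv_L2 alpha_gt0)
  (fun k A A' AA' DA a => le_trans (DA a) (lee_tofin AA')).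
exists (Num.sqrt (4%:R * A)) => t t0; rewrite (hbarE t0).
apply: (@sobolev_superposition _ _ _ mu 3 (fun k x z => D k (x - c z t))) => //.
- by move=> k _; exact: mD2.
- move=> k _; have [B DB] := kernel_deriv_bounded alpha_gt0 k.
  by exists B => x z; exact: DB.
- by move=> k z k3; exact: DA.
- by move=> k z phi; exact: kernel_deriv_weak.
Qed.

Lemma hbar_hoelder : exists C, forall s t, 0 <= s -> 0 <= t ->
  (sobolev_norm 3 (fun x => hbar alpha mu c t x - hbar alpha mu c s x)%R <=
   (C * `|t - s| `^ 2^-1)%:E)%E.
Proof.
have [A A0 DA] := @uniform_bound _ 3 _ (kernel_deriv_L2_translate alpha_gt0)
  (fun k A A' AA' DA a b => le_trans (DA a b)
     (lee_tofin (ler_wpM2r (normr_ge0 _) AA'))).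
have [L L0 cL] := solution_lipschitz.
(* The squared L^2 distance for each of the four orders 0 to 3 is at most A |c(z,t) - c(z,s)| <= A L
   |t - s|; the square root produces the exponent 1/2. *)
exists (Num.sqrt (4%:R * (A * L))) => s t s0 t0.
rewrite powR12_sqrt// -sqrtrM ?mulr_ge0// -!mulrA.
pose F k x z := D k (x - c z t) - D k (x - c z s).
have -> : (fun x => hbar alpha mu c t x - hbar alpha mu c s x) =
    (fun x => \int[mu]_z F 0%N x z).
  apply/funext => x; rewrite !hbarE// RintegralB//.
  - have [B DB] := kernel_deriv_bounded alpha_gt0 0.
    apply: (@integrable_bounded _ _ _ mu _ B) => //.
    exact: (measurableT_comp (mD2 0 t0) (measurable_pair1 x)).
  - have [B DB] := kernel_deriv_bounded alpha_gt0 0.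
    apply: (@integrable_bounded _ _ _ mu _ B) => //.
    exact: (measurableT_comp (mD2 0 s0) (measurable_pair1 x)).
have [] // := @sobolev_superposition _ _ _ mu 3 F (A * (L * `|t - s|)) mu_le1.
- by move=> k _; apply: measurable_funB; exact: mD2.
- move=> k _; have [B DB] := kernel_deriv_bounded alpha_gt0 k.
  by exists (B + B) => x z; rewrite (le_trans (ler_normB _ _))// lerD.
- move=> k z k3; apply: le_trans (DA k k3 _ _) _.
  by rewrite lee_fin ler_wpM2l// cL.
- move=> k z phi k3 tphi.
  have i0 a := integrable_kernel_deriv_test alpha_gt0 0 a k tphi.
  have ik a := integrable_kernel_deriv_test alpha_gt0 k a 0 tphi.
  (* The weak-derivative identity for the difference follows by linearity from the two
     translates. *)
  under eq_Rintegral do rewrite mulrBl.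
  under [in RHS]eq_Rintegral do rewrite mulrBl.
  by rewrite !RintegralB// mulrBr !kernel_deriv_weak.
Qed.

End solution.

Theorem theorem4p8 (R : realType) (alpha : R) (alpha_gt0 : 0 < alpha)
    (mu : {finite_measure set R -> \bar R})
    (mu_neq0 : exists A : set R, measurable A /\ mu A <> 0%E)
    (mu_le1 : (tv_norm mu <= 1)%E)
    (c : R -> R -> R) (cI : class_I c) (c_sol : is_solution alpha mu c) :
  (forall t : R, 0 <= t -> sobolev 3 (hbar alpha mu c t)) /\
  Cb_hoelder_sobolev 2^-1 3 (hbar alpha mu c).
Proof.
have mu1 : (mu setT <= 1)%E := le_trans (tv_norm_ge_setT mu) mu_le1.
have [A hA] := hbar_sobolev_bounded alpha_gt0 mu1 cI.
have hS t : 0 <= t -> sobolev 3 (hbar alpha mu c t) by move=> /hA[].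
split => //; split => //; first exact: hbar_hoelder.
apply: (@le_lt_trans _ _ A%:E); last exact: ltry.
by apply: ge_ereal_sup => _ [t t0 <-]; have [] := hA t t0.
Qed.
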